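(* Let $d, q\geq 4$ be natural numbers, and let $U$ be a subset of the vertices of the Hamming graph $H(d,q)$ with $|U|\geq 3q^{d-1}+1$. Then the VC-dimension of $(U,n(U))$ is $3$.
   Context: The Hamming graph $H(d,q)$ has vertex set $\mathbb Z_q^d$, with two vertices adjacent if and only if they differ in exactly one coordinate. For a vertex $x$, $n(x)$ denotes its neighborhood, the set of vertices adjacent to $x$ (so $x\notin n(x)$), and for a set $U$ of vertices $n(U)=\{n(u):u\in U\}$. A set $W\subseteq U$ is shattered by $n(U)$ if for every $S\subseteq W$ there is $u\in U$ with $n(u)\cap W=S$. The VC-dimension of $(U,n(U))$ is the size of the largest $W\subseteq U$ that is shattered by $n(U)$. *)

(* Defs.v *)
From mathcomp Require Import all_boot all_order all_algebra.
Set Implicit Arguments.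
Unset Strict Implicit.
Unset Printing Implicit Defensive.

(* 'Z_q has q elements only for 1 < q. *)
Definition hamming_vertex (d q : nat) := {ffun 'I_d -> 'Z_q}.

Definition hamming_adj (d q : nat) : rel (hamming_vertex d q) :=
  fun x y => #|[set i | x i != y i]| == 1.

Definition nbhd (T : finType) (e : rel T) (x : T) : {set T} :=
  [set y | e x y].

Definition nbhds (T : finType) (e : rel T) (U : {set T}) : {set {set T}} :=
  [set nbhd e u | u in U].

Definition shattered (T : finType) (F : {set {set T}}) (W : {set T}) : bool :=
  [forall S : {set T}, (S \subset W) ==> [exists A in F, A :&: W == S]].

(* The maximum over no W is 0; that happens only when F is empty, since set0 is
   shattered by every nonempty family. *)
Definition VCdim (T : finType) (U : {set T}) (F : {set {set T}}) : nat :=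
  \max_(W : {set T} | (W \subset U) && shattered F W) #|W|.

(* Main.v *)
(** Upper bound: two vertices of a shattered 4-set have at least three common
    neighbours, while vertices differing in two coordinates have at most two; so
    the 4-set is a clique, hence lies on a line, and then no vertex is adjacent
    to exactly two of its points.

    Lower bound: three points [x, y, z] of [U] on a line of direction [i] are
    shattered as soon as the line contains a fourth point of [U] and each of
    them has a neighbour in [U] off the line, since [U] is too large to be
    covered by three neighbourhoods.  Let [B i] be the set of points of [U] all
    of whose neighbours in [U] lie on their line of direction [i].  If no such
    triple exists in direction [i], then every line [L] of direction [i]
    satisfies [|L n U| + 2 |L n B j| <= 3 + |L n B i|] for [j <> i]
    (a point of [B j] on [L] is alone there); summing
    over the lines gives [|U| + 2 |B j| <= 3 q^(d-1) + |B i|], and adding the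
    same inequality with [i] and [j] exchanged contradicts [|U| > 3 q^(d-1)]. *)
Require Import Defs.
From mathcomp Require Import all_boot all_order all_algebra.
From mathcomp Require Import zify.

(** * Shattering by neighbourhoods in an arbitrary graph *)

Section Shattering.

Local Set Implicit Arguments.
Local Unset Strict Implicit.
Local Unset Printing Implicit Defensive.

Variables (T : finType) (e : rel T).
Implicit Types U W : {set T}.

Lemma shattered_nbhdsP U W : reflect
  (forall S : {set T}, S \subset W ->
     exists2 u, u \in U & {in W, forall v, e u v = (v \in S)})
  (shattered (nbhds e U) W).
Proof.
apply: (iffP forallP) => h S.
  move=> SW; have /existsP[A /andP[/imsetP[u uU ->] /eqP/setP eS]] := implyP (h S) SW.
  by exists u => // v vW; have:= eS v; rewrite !inE vW andbT.
apply/implyP => SW; have [u uU eS] := h S SW.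
apply/existsP; exists (nbhd e u); rewrite imset_f //=.
apply/eqP/setP => v; rewrite !inE; case vW: (v \in W); first by rewrite andbT eS.
by rewrite andbF; apply/esym/negbTE; apply: contraFN vW => /(subsetP SW).
Qed.

(** With [z], [w] two further points of [W], the traces [{x, y}], [{x, y, z}] and [{x, y, z, w}] are
    cut out by three different vertices, all adjacent to [x] and [y]. *)
Lemma shattered_common_nbrs U W x y : shattered (nbhds e U) W -> 3 < #|W| ->
  x \in W -> y \in W -> x != y ->
  2 < #|[set u | e u x && e u y]|.
Proof.
move=> /shattered_nbhdsP sh W4 xW yW xy.
have /card_gt1P[z [w []]] : 1 < #|W :\: [set x; y]|.
  have := cardsID [set x; y] W; have := subset_leq_card (subsetIr W [set x; y]).
  by rewrite cards2 xy; lia.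
rewrite !inE !negb_or => /andP[/andP[zx zy] zW] /andP[/andP[wx wy] wW] zw.
have sub (s : seq _) : all [in W] s -> [set v in s] \subset W.
  by move=> /allP ss; apply/subsetP => v; rewrite inE => /ss.
have [|u1 _ e1] := sh [set v in [:: x; y]]; first by apply: sub; rewrite /= xW yW.
have [|u2 _ e2] := sh [set v in [:: x; y; z]].
  by apply: sub; rewrite /= xW yW zW.
have [|u3 _ e3] := sh [set v in [:: x; y; z; w]].
  by apply: sub; rewrite /= xW yW zW wW.
apply/card_gt2P; exists u1, u2, u3.
split; split.
- by rewrite inE !e1 // !inE !eqxx ?orbT.
- by rewrite inE !e2 // !inE !eqxx ?orbT.
- by rewrite inE !e3 // !inE !eqxx ?orbT.
- apply/eqP => E; have := e2 z zW.
  by rewrite -E e1 // !inE (negbTE zx) (negbTE zy) eqxx ?orbT.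
- apply/eqP => E; have := e3 w wW.
  by rewrite -E e2 // !inE (negbTE wx) (negbTE wy) eq_sym (negbTE zw) eqxx ?orbT.
- apply/eqP => E; have := e3 z zW.
  by rewrite E e1 // !inE (negbTE zx) (negbTE zy) eqxx ?orbT.
Qed.

Lemma shattered3 U x y z :
  (forall bx by_ bz : bool, exists2 u, u \in U &
     [/\ e u x = bx, e u y = by_ & e u z = bz]) ->
  shattered (nbhds e U) [set x; y; z].
Proof.
move=> h; apply/shattered_nbhdsP => S _.
have [u uU [ex ey ez]] := h (x \in S) (y \in S) (z \in S).
by exists u => // v; rewrite !inE => /orP[/orP[]|] /eqP->.
Qed.

(** The neighbourhoods of the points of [W] cover at most [#|W| * D] vertices, too few to contain
    [U]. *)
Lemma far_vertex (D : nat) U W : symmetric e -> (forall x, #|nbhd e x| <= D) ->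
  #|W| * D < #|U| -> exists2 u, u \in U & {in W, forall x, ~~ e u x}.
Proof.
move=> esym hD hU; have /subsetPn[u uU uN] : ~~ (U \subset \bigcup_(x in W) nbhd e x).
  apply: contraTN hU => /subset_leq_card UW; rewrite -leqNgt (leq_trans UW) //.
  rewrite -sum_nat_const; elim/big_rec2: _ => [|x m A _ h]; first by rewrite cards0.
  by rewrite (leq_trans (leq_card_setU _ _)) // leq_add.
exists u => // x xW; apply: contraNN uN => ux.
by apply/bigcupP; exists x; rewrite // inE esym.
Qed.

End Shattering.

Lemma card_fibers (T T' : finType) (f : T -> T') (P : {pred T'}) (A : {set T}) :
  (forall x, f x \in P) ->
  #|A| = \sum_(t in P) #|[set x in A | f x == t]|.
Proof.
move=> fP; rewrite -sum1_card (partition_big f [in P]) //.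
by apply: eq_bigr => t _; rewrite -sum1_card; apply: eq_bigl => x; rewrite inE.
Qed.

(** * Lines and adjacency in the Hamming graph *)

Section Hamming.

Local Set Implicit Arguments.
Local Unset Strict Implicit.
Local Unset Printing Implicit Defensive.

Variables d q : nat.
Implicit Types (x y z u v : hamming_vertex d q) (i j k : 'I_d).
Implicit Types U W : {set hamming_vertex d q}.

Local Notation adj := (@hamming_adj d q).

(** Being on a common line of direction [i], with [x = y] allowed: an equivalence relation whose
    classes are these lines. *)
Definition agree_off i x y := [forall k, (k != i) ==> (x k == y k)].

Lemma agree_offP i x y :
  reflect (forall k, k != i -> x k = y k) (agree_off i x y).
Proof.
apply: (iffP forallP) => [h k ki | h k]; first exact/eqP/(implyP (h k)).
by apply/implyP => ki; rewrite h.
Qed.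
Arguments agree_offP {i x y}.

Lemma agree_off_sym i x y : agree_off i x y = agree_off i y x.
Proof. by apply: eq_forallb => k; rewrite [x k == _]eq_sym. Qed.

Lemma agree_off_trans i : transitive (agree_off i).
Proof.
by move=> y x z /agree_offP xy /agree_offP yz; apply/agree_offP => k ki; rewrite xy ?yz.
Qed.

Lemma agree_off_eq i x y : agree_off i x y -> x i = y i -> x = y.
Proof.
by move=> /agree_offP h hi; apply/ffunP => k; case: (eqVneq k i) => [-> | /h].
Qed.

Lemma agree_off_adj i x y : agree_off i x y -> adj x y = (x != y).
Proof.
move=> h; have [->|nxy] := eqVneq x y.
  by apply/negbTE/cards1P => -[k /setP/(_ k)]; rewrite !inE !eqxx.
have nxyi : x i != y i by apply: contraNneq nxy => /(agree_off_eq h) ->.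
apply/cards1P; exists i; apply/setP => k; rewrite !inE.
by case: (eqVneq k i) => [-> // | /(agree_offP h) ->]; rewrite eqxx.
Qed.

Lemma adjP x y :
  reflect (exists2 i, x i != y i & agree_off i x y) (adj x y).
Proof.
apply: (iffP idP) => [/cards1P[i /setP h] | [i xyi h]]; last first.
  by rewrite (agree_off_adj h); apply: contraNneq xyi => ->.
exists i; first by have:= h i; rewrite !inE eqxx.
apply/agree_offP => k ki; apply/eqP; have:= h k.
by rewrite !inE (negbTE ki) => /negbFE.
Qed.

Lemma adj_sym : symmetric adj.
Proof. by move=> x y; congr (_ == 1); apply: eq_card => k; rewrite !inE eq_sym. Qed.

(** * Common neighbours and the upper bound *)

Lemma adj_agree_off i x u : adj u x -> u i != x i -> agree_off i u x.
Proof.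
case/adjP => k _ h; case: (eqVneq i k) => [-> // | /(agree_offP h) ->].
by rewrite eqxx.
Qed.

(** Since [x i != y i], [u] differs at [i] from one of the two points, and its edge to that point
    then has direction [i]. *)
Lemma common_nbr_agree_off i x y u :
  agree_off i x y -> x != y -> adj u x -> adj u y -> agree_off i u x.
Proof.
move=> xy nxy ux uy; have [uxi | ] := eqVneq (u i) (x i); last exact: adj_agree_off.
apply: agree_off_trans (_ : agree_off i y x); last by rewrite agree_off_sym.
apply: adj_agree_off => //; rewrite uxi.
by apply: contraNneq nxy => /(agree_off_eq xy) ->.
Qed.

(** The single coordinates [a] and [b] in which [u] differs from [x] and from [y] must account for
    both [i] and [j]. Each alternative determines [u] from [x] and [y]. *)
Lemma common_nbr_cases i j x y u : i != j -> x i != y i -> x j != y j ->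
  adj u x -> adj u y ->
  (u i = y i /\ agree_off i u x) \/ (u j = y j /\ agree_off j u x).
Proof.
move=> ij xyi xyj /adjP[a uxa ua] /adjP[b uyb ub].
have [ea | nai] := eqVneq a i.
  left; rewrite -ea; split=> //; apply/(agree_offP ub).
  apply: contraNneq xyj => ab.
  rewrite -(agree_offP ua) 1?eq_sym ?ea //.
  by rewrite -(agree_offP ub) // -ab ea eq_sym.
have bi : b = i.
  apply/eqP; apply: contraNT xyi => nbi.
  by rewrite -(agree_offP ua) 1?eq_sym // -(agree_offP ub) 1?eq_sym.
have bj : b != j by rewrite bi.
have aj : a = j.
  apply/eqP; apply: contraNT xyj => naj.
  by rewrite -(agree_offP ua) 1?eq_sym // -(agree_offP ub) 1?eq_sym.
by right; rewrite -{1 2 3}aj; split; [apply/(agree_offP ub); rewrite aj eq_sym|].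
Qed.

(** Pigeonhole: if [x] and [y] differed in two coordinates, two of the three common neighbours would
    fall under the same alternative of [common_nbr_cases] and coincide. *)
Lemma three_common_nbrs_adj x y : x != y ->
  2 < #|[set u | adj u x && adj u y]| -> adj x y.
Proof.
move=> nxy /card_gt2P[u1 [u2 [u3 [[]]]]]; rewrite !inE.
move=> /andP[a1 b1] /andP[a2 b2] /andP[a3 b3] [n12 n23 n31].
have [i xyi] : exists i, x i != y i.
  apply/existsP; apply: contraNT nxy => /existsPn h.
  by apply/eqP/ffunP => k; apply/eqP/negbNE.
apply/adjP; exists i => //; apply/agree_offP => j ji; apply/eqP.
apply: contraT => xyj.
have uniq_on k u v : u k = y k /\ agree_off k u x ->
    v k = y k /\ agree_off k v x -> u = v.
  move=> [e h] [e' h']; apply: (@agree_off_eq k); last by rewrite e e'.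
  by apply: agree_off_trans h _; rewrite agree_off_sym.
have c := common_nbr_cases ji xyj xyi.
case: (c _ a1 b1) => h1; case: (c _ a2 b2) => h2; case: (c _ a3 b3) => h3;
  first [by move: n12; rewrite (uniq_on _ _ _ h1 h2) eqxx
     |by move: n31; rewrite (uniq_on _ _ _ h1 h3) eqxx
     |by move: n23; rewrite (uniq_on _ _ _ h2 h3) eqxx].
Qed.

Lemma shattered_card_le3 U W : shattered (nbhds adj U) W -> #|W| <= 3.
Proof.
move=> sh; rewrite leqNgt; apply/negP => W4.
have a v t : v \in W -> t \in W -> v != t -> adj v t.
  by move=> vW tW vt; exact: three_common_nbrs_adj vt (shattered_common_nbrs sh W4 vW tW vt).
have /card_geqP[s [un sz sW]] := W4.
case: s un sz sW => [|x [|y [|z [|w [|//]]]]] // un _ sW.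
have [xW yW zW wW] : [/\ x \in W, y \in W, z \in W & w \in W].
  by split; apply: sW; rewrite !inE eqxx ?orbT.
move: un; rewrite /= !inE !negb_or => /and4P[/and3P[xy xz xw] /andP[yz yw] zw _].
have [|u _ eu] := shattered_nbhdsP _ _ _ sh [set x; y].
  by apply/subsetP => v; rewrite !inE => /orP[] /eqP ->.
have /adjP[i xyi ixy] : adj x y by exact: a.
have ux : adj u x by rewrite eu // !inE eqxx.
have uy : adj u y by rewrite eu // !inE eqxx orbT.
have ix t : adj t x -> adj t y -> agree_off i t x by exact: common_nbr_agree_off.
(* Both [u] and [v] lie on the line through [x] and [y], and they are not adjacent because [u] has
   trace [{x, y}]; so [u = v]. Applied to [z] and [w], this gives [z = w]. *)
have on v : v \in W -> x != v -> y != v -> u = v.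
  move=> vW vx vy.
  have uv : agree_off i u v.
    apply: agree_off_trans (ix u ux uy) _; rewrite agree_off_sym.
    by apply: ix; apply: a; rewrite // eq_sym.
  apply/eqP/negbNE; rewrite -(agree_off_adj uv) eu //.
  by rewrite !inE ![v == _]eq_sym (negbTE vx) (negbTE vy).
by move: zw; rewrite -(on z) // -(on w) ?eqxx.
Qed.

(** * Lines of direction [i], each named by its point with [i]-th coordinate 0, and counting along
    them *)

Definition line_base i x : hamming_vertex d q :=
  [ffun k => if k == i then 0%R else x k].

Lemma line_base_eq i x y : (line_base i x == line_base i y) = agree_off i x y.
Proof.
apply/eqP/agree_offP => [/ffunP h k ki | h].
  by have := h k; rewrite !ffunE (negbTE ki).
by apply/ffunP => k; rewrite !ffunE; case: eqVneq => // /h.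
Qed.

Definition line_points i U t := [set u in U | line_base i u == t].

Lemma card_line_bases i : 1 < q ->
  #|[set x : hamming_vertex d q | x i == 0%R]| = q ^ (d - 1).
Proof.
move=> q1; transitivity #|pffun_on (0%R : 'Z_q) (predC1 i) predT|.
  apply: eq_card => x; rewrite inE; apply/eqP/pffun_onP => [xi | [/subsetP h _]].
    by split=> //; apply/subsetP => k; rewrite !inE; apply: contraNneq => ->; rewrite xi.
  by apply/eqP; apply: contraT => /(h i); rewrite !inE eqxx.
by rewrite card_pffun_on cardC1 !card_ord Zp_cast // subn1.
Qed.

(** The set [B i] of the overview. *)
Definition tied i U :=
  [set u in U | [forall v in U, adj u v ==> agree_off i u v]].

Lemma tiedP i U u v : u \in tied i U -> v \in U -> adj u v -> agree_off i u v.
Proof. by rewrite inE => /andP[_ /forall_inP h] /h /implyP. Qed.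

Definition rich i U := [exists t,
  (3 < #|line_points i U t|) && (2 < #|line_points i U t :\: tied i U|)].

Lemma line_points_le i j U t : i != j -> ~~ rich i U ->
  #|line_points i U t| + 2 * #|line_points i (tied j U) t|
    <= 3 + #|line_points i (tied i U) t|.
Proof.
move=> ij poor; have [-> | [u]] := set_0Vmem (line_points i (tied j U) t).
  rewrite cards0 muln0 addn0.
  case: (leqP #|line_points i U t| 3) => [le3 | gt3]; first exact: leq_trans (leq_addr _ _).
  case: (leqP #|line_points i U t :\: tied i U| 2) => [le2 | gt2]; last first.
    by case/existsP: poor; exists t; rewrite gt3.
  rewrite -(cardsID (tied i U)) addnC leq_add //; first exact: leq_trans le2 _.
  apply/subset_leq_card/subsetP => v; rewrite 2!inE => /andP[/andP[_ vt] vi].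
  by rewrite inE vi.
rewrite inE => /andP[uj /eqP ut].
(* Another point [v] of [U] on this line would be adjacent to [u] along [i], whereas [u] has
   neighbours in [U] along [j] only. *)
have single : line_points i U t \subset [set u].
  apply/subsetP => v; rewrite !inE => /andP[vU /eqP vt].
  have uv : agree_off i u v by rewrite -line_base_eq ut vt.
  rewrite eq_sym; apply: contraT => nuv.
  have uv' : agree_off j u v by apply: (tiedP uj vU); rewrite (agree_off_adj uv).
  by rewrite (agree_off_eq uv (agree_offP uv' i ij)) eqxx in nuv.
have tied_sub : line_points i (tied j U) t \subset line_points i U t.
  by apply/subsetP => v; rewrite !inE => /andP[/andP[-> _] ->].
apply: leq_trans (leq_addr _ 3).
rewrite (leq_add (_ : _ <= 1) (_ : _ <= 2)) //.
  by rewrite -(cards1 u) subset_leq_card.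
by rewrite (leq_mul2l 2 _ 1) -(cards1 u) subset_leq_card // (subset_trans tied_sub).
Qed.

Lemma poor_card i j U : 1 < q -> i != j -> ~~ rich i U ->
  #|U| + 2 * #|tied j U| <= 3 * q ^ (d - 1) + #|tied i U|.
Proof.
move=> q1 ij poor.
have base x : line_base i x \in [set x : hamming_vertex d q | x i == 0%R].
  by rewrite inE ffunE eqxx.
have fib A := card_fibers _ _ _ _ A base.
rewrite (fib U) (fib (tied j U)) (fib (tied i U)) -(card_line_bases i q1).
rewrite [3 * _]mulnC -sum_nat_const big_distrr -!big_split /=.
by apply: leq_sum => t _; exact: line_points_le.
Qed.

(** * Degree bound and the shattered triple *)

Lemma degree_le x : 1 < q -> #|nbhd adj x| <= d * q.
Proof.
move=> q1; pose move_to (p : 'I_d * 'Z_q) : hamming_vertex d q :=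
  [ffun k => if k == p.1 then p.2 else x k].
have -> : d * q = #|[set: 'I_d * 'Z_q]|.
  by rewrite cardsT card_prod !card_ord Zp_cast.
apply: leq_trans (leq_imset_card move_to _).
apply/subset_leq_card/subsetP => y; rewrite inE => /adjP[i _ xy].
apply/imsetP; exists (i, y i); rewrite ?inE //; apply/ffunP => k; rewrite ffunE /=.
by case: eqVneq => [-> // | /(agree_offP xy)].
Qed.

(** A neighbour of [x] off the line cannot be adjacent to a second point [y] of the line: a common
    neighbour of [x] and [y] lies on it. *)
Lemma off_line_nbr i U t x : x \in line_points i U t :\: tied i U ->
  exists2 u, u \in U & adj u x /\
    forall y, y \in line_points i U t -> y != x -> adj u y = false.
Proof.
rewrite !inE => /andP[+ /andP[xU xt]]; rewrite xU => /forall_inPn[u uU].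
rewrite negb_imply => /andP[xu nxu]; exists u => //; split; first by rewrite adj_sym.
move=> y; rewrite inE => /andP[_ yt] yx; apply: contraNF nxu => uy.
rewrite agree_off_sym; apply: (common_nbr_agree_off _ _ _ uy); rewrite 1?adj_sym //.
  by rewrite -line_base_eq (eqP xt) (eqP yt).
by rewrite eq_sym.
Qed.

Lemma rich_shattered i U : 1 < q -> 3 * (d * q) < #|U| -> rich i U ->
  exists W, [/\ W \subset U, shattered (nbhds adj U) W & #|W| = 3].
Proof.
move=> q1 hU /existsP[t /andP[four /card_gt2P[x [y [z [[xL yL zL] [xy yz zx]]]]]]].
have [sub yx zy xz] : [/\ {subset line_points i U t :\: tied i U <= line_points i U t},
    y != x, z != y & x != z].
  by split; rewrite 1?eq_sym //; apply/subsetP; exact: subsetDl.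
have inU v : v \in line_points i U t -> v \in U by rewrite inE => /andP[].
have lineE v s : v \in line_points i U t -> s \in line_points i U t -> adj v s = (v != s).
  rewrite !inE => /andP[_ vt] /andP[_ st]; apply: (@agree_off_adj i).
  by rewrite -line_base_eq (eqP vt) (eqP st).
have c3 : #|[set x; y; z]| = 3.
  by rewrite setUC cardsU1 cards2 !inE xy negb_or zx zy.
exists [set x; y; z]; split=> //.
  by apply/subsetP => v; rewrite !inE => /orP[/orP[]|] /eqP ->; apply/inU/sub.
have [ux uxU [uxx uxN]] := off_line_nbr xL.
have [uy uyU [uyy uyN]] := off_line_nbr yL.
have [uz uzU [uzz uzN]] := off_line_nbr zL.
have /subsetPn[w wL wN] : ~~ (line_points i U t \subset [set x; y; z]).
  by apply: contraTN four => /subset_leq_card; rewrite c3 -leqNgt.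
have [f fU fN] : exists2 f, f \in U & {in [set x; y; z], forall v, ~~ adj f v}.
  by apply: (far_vertex adj_sym (fun v => degree_le v q1)); rewrite c3.
have /and3P[fx fy fz] : [&& ~~ adj f x, ~~ adj f y & ~~ adj f z].
  by rewrite !fN // !inE eqxx ?orbT.
move: wN; rewrite !inE !negb_or => /andP[/andP[wx wy] wz].
have [[xL' yL'] zL'] := (sub _ xL, sub _ yL, sub _ zL).
(* The eight traces: [w], a fourth point of the line, sees all three; each of [x], [y], [z] sees the
   other two; [ux], [uy], [uz] see one each; [f] sees none. *)
apply: (@shattered3 _ adj U x y z); case; case; case.
- by exists w; [exact: inU | rewrite !lineE].
- by exists z; [exact: inU | rewrite !lineE // eqxx].
- by exists y; [exact: inU | rewrite !lineE // eqxx].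
- by exists ux => //; rewrite uxx !uxN.
- by exists x; [exact: inU | rewrite !lineE // eqxx].
- by exists uy => //; rewrite uyy !uyN.
- by exists uz => //; rewrite uzz !uzN.
- by exists f => //; rewrite (negbTE fx) (negbTE fy) (negbTE fz).
Qed.

End Hamming.

Theorem corollary1p4 (d q : nat) (hd : 4 <= d) (hq : 4 <= q)
    (U : {set hamming_vertex d q}) (hU : 3 * q ^ (d - 1) + 1 <= #|U|) :
  VCdim U (nbhds (@hamming_adj d q) U) = 3.
Proof.
have q1 : 1 < q by lia.
(* This makes [U] larger than three neighbourhoods together. From [d - 3 < q ^ (d - 3)] and
   [q >= 4], [q ^ (d - 2) >= 4 * (d - 2) >= d]. *)
have dq : d * q <= q ^ (d - 1).
  have -> : d - 1 = (d - 3).+2 by lia.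
  have := ltn_expl (d - 3) q1; rewrite !expnS; nia.
have [i0 [i1 i01]] : exists i j : 'I_d, i != j.
  by exists (Ordinal (leq_trans (isT : 0 < 4) hd)), (Ordinal (leq_trans (isT : 1 < 4) hd)).
apply/eqP; rewrite eqn_leq; apply/andP; split.
  by apply/bigmax_leqP => W /andP[_ /shattered_card_le3].
have [i rich_i] : exists i, rich i U.
  apply/existsP; apply: contraT => /existsPn poor.
  have := poor_card q1 i01 (poor i0).
  by have := poor_card q1 (_ : i1 != i0) (poor i1); rewrite eq_sym i01; lia.
have [|W [WU sh <-]] := rich_shattered q1 _ rich_i; first by lia.
by apply: leq_bigmax_cond; rewrite WU.
Qed.
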